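(* Let $\Phi\in\mathcal{E}(I)$ and $f:I\to\mathbb{R}$. Consider the following conditions: (i) $f$ is $\Phi$-affine; (ii) for all $x,u,y\in I$ with $x<u<y$, $$\left|\frac{f(u)-f(x)}{u-x}-\frac{f(y)-f(u)}{y-u}\right|\leq\frac{\Phi(u-x)}{u-x}+\frac{\Phi(y-u)}{y-u};$$ (iii) there exists a function $\varphi:I\to\mathbb{R}$ such that, for all $x,u\in I$, $$|f(u)-f(x)-(u-x)\varphi(u)|\leq \Phi(|u-x|);$$ (iv) for all $n\in\mathbb{N}$, $x_1,\dots,x_n\in I$, and $t_1,\dots,t_n\geq0$ with $t_1+\dots+t_n=1$, $$\Big|f(t_1x_1+\dots+t_nx_n)-\sum_{i=1}^{n}t_if(x_i)\Big|\leq \sum_{i=1}^{n}t_i\Phi(|(t_1x_1+\dots+t_nx_n)-x_i|).$$ Then (i), (ii) and (iv) are equivalent to each other and, provided that $\Phi$ is increasing, they are also equivalent to (iii).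
   Context: $I\subseteq\mathbb{R}$ is a nonempty open interval and $\ell(I)\in(0,\infty]$ is its length. $\mathcal{E}(I)$ is the set of all functions $\Phi:[0,\ell(I))\to[0,\infty)$ (called error functions). ''Increasing'' is meant in the non-strict sense ($s\leq t$ implies $\Phi(s)\leq\Phi(t)$). For $\Phi\in\mathcal{E}(I)$, a function $f:I\to\mathbb{R}$ is called $\Phi$-affine if for all $x,y\in I$ and $t\in[0,1]$, $$|f(tx+(1-t)y)-tf(x)-(1-t)f(y)|\leq t\Phi((1-t)|x-y|)+(1-t)\Phi(t|x-y|).$$ *)

(* Defs.v *)
From HB Require Import structures.
From mathcomp Require Import all_boot all_order all_algebra.
From mathcomp Require Import all_classical all_reals.
From mathcomp Require Import ereal topology normedtype.

Set Implicit Arguments.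
Unset Strict Implicit.
Unset Printing Implicit Defensive.

Import Order.TTheory GRing.Theory Num.Theory.
Import numFieldNormedType.Exports.

Local Open Scope classical_set_scope.
Local Open Scope ring_scope.

(* Functions on I and on [0, l(I)) are represented by total functions R -> R;
   only their values on I, resp. on [0, l(I)), are ever used: if x, y lie in
   the open interval I then 0 <= `|x - y| < l(I). *)

Definition open_interval (R : realType) (I : set R) : Prop :=
  [/\ I !=set0, open I & is_interval I].

(* For I nonempty and open, sup I > -oo and inf I < +oo, so the difference of
   extended reals is never of the form oo - oo. *)
Definition interval_length (R : realType) (I : set R) : \bar R :=
  (ereal_sup (EFin @` I) - ereal_inf (EFin @` I))%E.

Definition error_domain (R : realType) (I : set R) : set R :=
  [set s | 0 <= s /\ (s%:E < interval_length I)%E].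

Definition error_function (R : realType) (I : set R) (Phi : R -> R) : Prop :=
  forall s, error_domain I s -> 0 <= Phi s.

Definition error_increasing (R : realType) (I : set R) (Phi : R -> R) : Prop :=
  forall s t, error_domain I s -> error_domain I t -> s <= t -> Phi s <= Phi t.

Definition Phi_affine (R : realType) (I : set R) (Phi f : R -> R) : Prop :=
  forall x y t : R, I x -> I y -> 0 <= t <= 1 ->
    `|f (t * x + (1 - t) * y) - t * f x - (1 - t) * f y|
      <= t * Phi ((1 - t) * `|x - y|) + (1 - t) * Phi (t * `|x - y|).

Definition slope_condition (R : realType) (I : set R) (Phi f : R -> R) : Prop :=
  forall x u y : R, I x -> I u -> I y -> x < u -> u < y ->
    `|(f u - f x) / (u - x) - (f y - f u) / (y - u)|
      <= Phi (u - x) / (u - x) + Phi (y - u) / (y - u).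

Definition support_condition (R : realType) (I : set R) (Phi f : R -> R) : Prop :=
  exists phi : R -> R, forall x u : R, I x -> I u ->
    `|f u - f x - (u - x) * phi u| <= Phi `|u - x|.

Definition jensen_condition (R : realType) (I : set R) (Phi f : R -> R) : Prop :=
  forall (n : nat) (x t : 'I_n -> R),
    (forall i, I (x i)) -> (forall i, 0 <= t i) -> \sum_(i < n) t i = 1 ->
    let m := \sum_(i < n) t i * x i in
    `|f m - \sum_(i < n) t i * f (x i)|
      <= \sum_(i < n) t i * Phi `|m - x i|.

(* Main.v *)
Require Import Defs.
From HB Require Import structures.
From mathcomp Require Import all_boot all_order all_algebra.
From mathcomp Require Import all_classical all_reals.
From mathcomp Require Import ereal topology normedtype.
From mathcomp Require Import ring lra.

(** Fix [u] in [I] and call an admissible slope at [u] any [c] such that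
    [f u - f x - (u - x) * c] is controlled by [Phi `|u - x|] for all [x].
    Admissible slopes turn pointwise estimates into Jensen-type ones: when [u]
    is the barycentre of the [x i], averaging makes the terms [(u - x i) * c]
    cancel ([jensen_of_support]).  Jensen's inequality with two points is
    [Phi_affine], and [Phi_affine] is the slope condition after multiplication
    by a positive factor ([three_point]), so it remains to find admissible
    slopes from the slope condition.

    Dividing by [u - x] turns each point [x] into a closed interval of slopes
    [c], centred at [slope f x u] with radius [Phi `|u - x| / `|u - x|].  The
    slope condition says that the interval of a point on the left of [u] meets
    that of any point on the right.

    For Jensen's inequality the upper and lower estimates may use different
    slopes.  The upper estimate bounds [c] from below through points on the
    left and from above through points on the right, so the slope condition is
    exactly what is needed to separate the two families of bounds
    ([one_sided_support]); the lower estimate is the upper one for [- f].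

    The support condition asks for one [c] that serves both estimates, so the
    intervals of two points on the same side of [u] must meet as well.  If
    [x < y < u], the slope over [x, u] is a mean of those over [x, y] and
    [y, u]; the slope condition for this triple then gives the claim, but with
    [Phi (y - x)] in place of [Phi (u - x)] ([mean_slope_gap]).  This is where
    monotonicity of [Phi] enters.  Pairwise intersecting closed intervals on a
    line have a common point. *)

Set Implicit Arguments.
Unset Strict Implicit.
Unset Printing Implicit Defensive.

Import Order.TTheory GRing.Theory Num.Theory.
Import numFieldNormedType.Exports.

Local Open Scope classical_set_scope.
Local Open Scope ring_scope.

(** * Open intervals and barycentres *)

Lemma open_gt (R : realType) (I : set R) (x : R) :
  open I -> I x -> exists2 y, I y & x < y.
Proof.
move=> oI Ix; have /nbhs_ballP[e /= e0 sub] := open_nbhs_nbhs (conj oI Ix).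
exists (x + e / 2); last by rewrite ltrDl divr_gt0.
apply: sub; rewrite /ball /= opprD addNKr normrN gtr0_norm ?divr_gt0 //.
by lra.
Qed.

Lemma open_lt (R : realType) (I : set R) (x : R) :
  open I -> I x -> exists2 y, I y & y < x.
Proof.
move=> oI Ix; have /nbhs_ballP[e /= e0 sub] := open_nbhs_nbhs (conj oI Ix).
exists (x - e / 2); last by rewrite gtrBl divr_gt0.
apply: sub; rewrite /ball /= opprB addrC subrK gtr0_norm ?divr_gt0 //.
by lra.
Qed.

(** The strict inequality comes from openness: a point of [I] beyond the larger
    of [x] and [y] makes the length exceed their distance. *)
Lemma error_domain_dist (R : realType) (I : set R) (x y : R) :
  open I -> I x -> I y -> error_domain I `|x - y|.
Proof.
move=> oI; wlog le_yx : x y / y <= x => [W Ix Iy|Ix Iy].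
  by case: (leP y x) => [|/ltW] yx; [|rewrite distrC]; apply: W.
split; first exact: normr_ge0.
have [z Iz xz] := open_gt oI Ix.
rewrite ger0_norm ?subr_ge0 //.
have zS : (z%:E <= ereal_sup (EFin @` I))%E by apply: ereal_sup_ubound; exists z.
have yi : (ereal_inf (EFin @` I) <= y%:E)%E by apply: ereal_inf_lbound; exists y.
apply: (@lt_le_trans _ _ (z%:E - y%:E)%E); first by rewrite -EFinB lte_fin ltrD2r.
exact: leeB.
Qed.

(** Otherwise all deviations [x i - m] from the barycentre [m] are positive,
    although their weighted mean vanishes.  Applied to [x] and to [- x], this
    brackets [m] between two of the points. *)
Lemma barycentre_ge_some (R : realFieldType) (n : nat) (x t : 'I_n -> R) :
  (forall i, 0 <= t i) -> \sum_(i < n) t i = 1 ->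
  exists i, x i <= \sum_(i < n) t i * x i.
Proof.
move=> t0 t1; set m := \sum_(i < n) _.
case: (pickP (fun i => x i <= m)) => [i xi|none]; first by exists i.
have gtm i : m < x i by rewrite ltNge none.
have sum0 : \sum_(i < n) t i * (x i - m) = 0.
  under eq_bigr do rewrite mulrBr.
  by rewrite sumrB -mulr_suml t1 mul1r subrr.
have term_ge0 i : true -> 0 <= t i * (x i - m).
  by move=> _; rewrite mulr_ge0 // subr_ge0 ltW.
case/eqP: (oner_neq0 R); rewrite -t1 big1 // => i _.
have := @psumr_eq0P _ _ _ _ term_ge0 sum0 i isT.
by move/eqP; rewrite mulf_eq0 subr_eq0 (gt_eqF (gtm i)) orbF => /eqP.
Qed.

Lemma interval_barycentre (R : realType) (I : set R) (n : nat)
    (x t : 'I_n -> R) :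
  is_interval I -> (forall i, I (x i)) -> (forall i, 0 <= t i) ->
  \sum_(i < n) t i = 1 -> I (\sum_(i < n) t i * x i).
Proof.
move=> itvI Ix t0 t1.
have [i xi] := barycentre_ge_some x t0 t1.
have [j /= xj] := barycentre_ge_some (fun i => - x i) t0 t1.
apply: (itvI _ _ (Ix i) (Ix j)); rewrite xi /=.
move: xj; under eq_bigr do rewrite mulrN.
by rewrite sumrN lerN2.
Qed.

(** * Slopes *)

Definition slope (R : realFieldType) (f : R -> R) (x u : R) : R :=
  (f u - f x) / (u - x).

Definition slope_error (R : realFieldType) (Phi : R -> R) (x u : R) : R :=
  Phi `|u - x| / `|u - x|.

Lemma slopeC (R : realFieldType) (f : R -> R) (x u : R) :
  slope f x u = slope f u x.
Proof. by rewrite /slope -(opprB (f x)) -(opprB x) invrN mulrNN. Qed.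

Lemma slope_errorC (R : realFieldType) (Phi : R -> R) (x u : R) :
  slope_error Phi x u = slope_error Phi u x.
Proof. by rewrite /slope_error distrC. Qed.

Lemma slope_error_lt (R : realFieldType) (Phi : R -> R) (x u : R) :
  x < u -> slope_error Phi x u = Phi (u - x) / (u - x).
Proof. by move=> xu; rewrite /slope_error gtr0_norm ?subr_gt0. Qed.

(** Multiplying the first inequality by the positive number [h * k / (h + k)]
    gives the second one. *)
Lemma three_point (R : realFieldType) (h k a b c p q : R) :
  0 < h -> 0 < k ->
  (`|(b - a) / h - (c - b) / k| <= p / h + q / k) =
  (`|b - k / (h + k) * a - h / (h + k) * c|
     <= k / (h + k) * p + h / (h + k) * q).
Proof.
move=> h0 k0; have hk0 : 0 < h + k by rewrite addr_gt0.
have r0 : 0 < h * k / (h + k) by rewrite divr_gt0 // mulr_gt0.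
rewrite -(ler_pM2l r0) -{1}(gtr0_norm r0) -normrM.
by congr (`|_| <= _); field; rewrite !gt_eqF.
Qed.

(** The mean slope differs from [B] by [h / (h + k) * (A - B)]. *)
Lemma mean_slope_gap (R : realFieldType) (h k A B p q P : R) :
  0 < h -> 0 < k -> 0 <= q -> p <= P -> `|A - B| <= p / h + q / k ->
  `|(h * A + k * B) / (h + k) - B| <= P / (h + k) + q / k.
Proof.
move=> h0 k0 q0 pP AB; have hk0 : 0 < h + k by rewrite addr_gt0.
have -> : (h * A + k * B) / (h + k) - B = h / (h + k) * (A - B).
  by field; rewrite gt_eqF.
have r0 : 0 < h / (h + k) by rewrite divr_gt0.
rewrite normrM gtr0_norm //.
apply: (le_trans (ler_wpM2l (ltW r0) AB)).
have -> : h / (h + k) * (p / h + q / k) = p / (h + k) + h / (h + k) * (q / k).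
  by field; rewrite !gt_eqF.
apply: lerD; first by rewrite ler_pM2r ?invr_gt0.
apply: ler_piMl; first by rewrite divr_ge0 // ltW.
by rewrite ler_pdivrMr // mul1r lerDl ltW.
Qed.

Lemma slope_meanE (R : realFieldType) (f : R -> R) (x u y : R) :
  x < u -> u < y ->
  slope f x y = ((u - x) * slope f x u + (y - u) * slope f u y)
                / ((u - x) + (y - u)).
Proof.
move=> xu uy; rewrite /slope; field.
by rewrite !gt_eqF ?subr_gt0 // ?(lt_trans xu) // addr_gt0 // subr_gt0.
Qed.

(** * Admissible slopes *)

Section SlopeCondition.
Variables (R : realType) (I : set R) (Phi : R -> R).
Hypotheses (hI : open_interval I) (hPhi : error_function I Phi).

Let oI : open I. Proof. by case: hI. Qed.

Lemma error_dist_ge0 x y : I x -> I y -> 0 <= Phi `|x - y|.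
Proof. by move=> Ix Iy; apply/hPhi/error_domain_dist. Qed.

Lemma slope_conditionE f x u y : slope_condition I Phi f ->
  I x -> I u -> I y -> x < u -> u < y ->
  `|slope f x u - slope f u y| <= slope_error Phi x u + slope_error Phi u y.
Proof.
move=> sc Ix Iu Iy xu uy; rewrite !slope_error_lt //.
exact: sc.
Qed.

Lemma slope_conditionN f :
  slope_condition I Phi f -> slope_condition I Phi (fun x => - f x).
Proof.
move=> sc x u y Ix Iu Iy xu uy.
have := sc x u y Ix Iu Iy xu uy; rewrite -normrN.
by congr (`|_| <= _); ring.
Qed.

(** The slope condition is the instance [t = (y - u) / (y - x)], for which the
    convex combination of [x] and [y] is [u]. *)
Lemma affine_slope f : Phi_affine I Phi f -> slope_condition I Phi f.
Proof.
move=> aff x u y Ix Iu Iy xu uy.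
have h0 : 0 < u - x by rewrite subr_gt0.
have k0 : 0 < y - u by rewrite subr_gt0.
rewrite three_point //; set s := u - x + (y - u).
have s0 : 0 < s by rewrite addr_gt0.
have sE : s = y - x by rewrite /s; ring.
have tE : 1 - (y - u) / s = (u - x) / s.
  by rewrite /s; field; rewrite gt_eqF.
have t01 : 0 <= (y - u) / s <= 1.
  by rewrite -(subr_ge0 _ 1) tE; apply/andP; split; apply/ltW/divr_gt0.
have := aff x y _ Ix Iy t01; rewrite tE.
rewrite (_ : `|x - y| = s); last by rewrite distrC -sE gtr0_norm.
rewrite !divfK ?gt_eqF //.
suff -> : (y - u) / s * x + (u - x) / s * y = u by [].
by rewrite sE; field; rewrite -sE gt_eqF.
Qed.

(** The existence of a separating point is completeness of the reals;
    openness of [I] provides points on both sides of [u], so that the bounds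
    coming from the left form a nonempty bounded set. *)
Lemma one_sided_support f u : slope_condition I Phi f -> I u ->
  exists c, forall x, I x -> f u - f x - (u - x) * c <= Phi `|u - x|.
Proof.
move=> sc Iu.
pose A := [set slope f x u - slope_error Phi x u | x in [set x | I x /\ x < u]].
have AB x y : I x -> I y -> x < u -> u < y ->
    slope f x u - slope_error Phi x u <= slope f u y + slope_error Phi u y.
  move=> Ix Iy xu uy; have := slope_conditionE sc Ix Iu Iy xu uy.
  by rewrite ler_norml => /andP[_]; lra.
have [x0 Ix0 x0u] := open_lt oI Iu.
have [y0 Iy0 uy0] := open_gt oI Iu.
have A0 : A !=set0 by eexists; exists x0.
have supA : has_sup A.
  split=> //; exists (slope f u y0 + slope_error Phi u y0) => _ [x [Ix xu] <-].
  exact: AB.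
exists (sup A) => x Ix; have [xu|ux|<-] := ltgtP x u.
- have : slope f x u - slope_error Phi x u <= sup A.
    by apply: (sup_upper_bound supA); exists x.
  rewrite /slope /slope_error gtr0_norm ?subr_gt0 // -mulrBl.
  by rewrite ler_pdivrMr ?subr_gt0 //; lra.
- have : sup A <= slope f u x + slope_error Phi u x.
    by apply: ge_sup => // _ [z [Iz zu] <-]; apply: AB.
  rewrite distrC /slope /slope_error gtr0_norm ?subr_gt0 // -mulrDl.
  by rewrite ler_pdivlMr ?subr_gt0 //; lra.
- by have := error_dist_ge0 Ix Ix; rewrite !subrr mul0r subr0.
Qed.

(** The intervals of slopes attached to two points of [I] meet.  Monotonicity
    serves when both points lie on the same side of [u]. *)
Lemma slope_gap f u x y : error_increasing I Phi -> slope_condition I Phi f ->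
  I u -> I x -> I y -> x != u -> y != u ->
  `|slope f x u - slope f y u| <= slope_error Phi x u + slope_error Phi y u.
Proof.
move=> inc sc Iu; wlog xy : x y / x < y => [W|] Ix Iy xu yu.
  case: (ltgtP x y) => [|yx|<-]; first by move=> ?; apply: W.
    by rewrite distrC [leRHS]addrC; apply: W.
  by rewrite subrr normr0 addr_ge0 // divr_ge0 // error_dist_ge0.
have mono a b c d : I a -> I b -> I c -> I d -> a < b -> c < d ->
    b - a <= d - c -> Phi (b - a) <= Phi (d - c).
  move=> Ia Ib Ic Id ab cd.
  have := error_domain_dist oI Id Ic; have := error_domain_dist oI Ib Ia.
  by rewrite !gtr0_norm ?subr_gt0 // => ? ?; apply: inc.
have Phi0 a b : I a -> I b -> a < b -> 0 <= Phi (b - a).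
  move=> Ia Ib ab; have := error_dist_ge0 Ib Ia.
  by rewrite gtr0_norm ?subr_gt0.
move: xu yu; rewrite !neq_lt => /orP[xu|ux] /orP[yu|uy].
- rewrite (slope_meanE f xy yu) !slope_error_lt //.
  rewrite [in X in _ <= X + _](_ : u - x = (y - x) + (u - y)); last by ring.
  apply: (mean_slope_gap _ _ _ _ (sc _ _ _ Ix Iy Iu xy yu));
    rewrite ?subr_gt0 ?Phi0 //.
  by rewrite (_ : y - x + _ = u - x); [apply: mono => //; lra | ring].
- rewrite (slopeC f y) (slope_errorC Phi y).
  exact: slope_conditionE.
- by have := lt_trans xy (lt_trans yu ux); rewrite ltxx.
- rewrite !(slopeC f _ u) !(slope_errorC Phi _ u) distrC [leRHS]addrC.
  rewrite (slope_meanE f ux xy) !slope_error_lt //.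
  rewrite [X in `|X / _ - _|]addrC (addrC (x - u)).
  rewrite [in X in _ <= X + _](_ : y - u = (y - x) + (x - u)); last by ring.
  have := sc _ _ _ Iu Ix Iy ux xy; rewrite distrC [leRHS]addrC => sc_uxy.
  apply: (mean_slope_gap _ _ _ _ sc_uxy); rewrite ?subr_gt0 ?Phi0 //.
  by rewrite (_ : y - x + _ = y - u); [apply: mono => //; lra | ring].
Qed.

(** By [slope_gap] no lower end of an interval of slopes exceeds an upper end,
    so the supremum of the lower ends belongs to every interval. *)
Lemma slope_support f : error_increasing I Phi -> slope_condition I Phi f ->
  support_condition I Phi f.
Proof.
move=> inc sc.
suff ex u : exists c, I u -> forall x, I x ->
    `|f u - f x - (u - x) * c| <= Phi `|u - x|.
  have [phi phiP] := choice ex.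
  by exists phi => x u Ix Iu; apply: phiP.
have [Iu|nIu] := pselect (I u); last by exists 0.
pose A := [set slope f x u - slope_error Phi x u | x in [set x | I x /\ x != u]].
have AB x y : I x -> I y -> x != u -> y != u ->
    slope f x u - slope_error Phi x u <= slope f y u + slope_error Phi y u.
  move=> Ix Iy xu yu; have := slope_gap inc sc Iu Ix Iy xu yu.
  by rewrite ler_norml => /andP[_]; lra.
have [x0 Ix0 /lt_eqF/negbT x0u] := open_lt oI Iu.
have A0 : A !=set0 by eexists; exists x0.
have supA : has_sup A.
  split=> //; exists (slope f x0 u + slope_error Phi x0 u) => _ [x [Ix xu] <-].
  exact: AB.
exists (sup A) => _ x Ix; have [->|xu] := eqVneq x u.
  by have := error_dist_ge0 Iu Iu; rewrite !subrr mul0r subr0 normr0.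
have lb : slope f x u - slope_error Phi x u <= sup A.
  by apply: (sup_upper_bound supA); exists x.
have ub : sup A <= slope f x u + slope_error Phi x u.
  by apply: ge_sup => // _ [z [Iz zu] <-]; apply: AB.
have ux0 : u - x != 0 by rewrite subr_eq0 eq_sym.
have -> : f u - f x - (u - x) * sup A = (u - x) * (slope f x u - sup A).
  by rewrite mulrBr /slope mulrCA divff // mulr1.
rewrite normrM mulrC -ler_pdivlMr ?normr_gt0 // ler_norml.
by move: lb ub; rewrite /slope_error; lra.
Qed.

(** * Jensen's inequality *)

(** Averaging the estimates with weights [t i] removes [c], because the
    deviations of the points from their barycentre average to zero. *)
Lemma jensen_of_support f c n (x t : 'I_n -> R) (m := \sum_(i < n) t i * x i) :
  (forall i, 0 <= t i) -> \sum_(i < n) t i = 1 ->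
  (forall i, f m - f (x i) - (m - x i) * c <= Phi `|m - x i|) ->
  f m - \sum_(i < n) t i * f (x i) <= \sum_(i < n) t i * Phi `|m - x i|.
Proof.
move=> t0 t1 supp.
suff -> : f m - \sum_(i < n) t i * f (x i)
    = \sum_(i < n) t i * (f m - f (x i) - (m - x i) * c).
  by apply: ler_sum => i _; apply: ler_wpM2l.
have dev0 : \sum_(i < n) t i * (m - x i) = 0.
  under eq_bigr do rewrite mulrBr.
  by rewrite sumrB -mulr_suml t1 mul1r subrr.
under [RHS]eq_bigr do rewrite !mulrBr mulrA.
by rewrite !sumrB -!mulr_suml t1 mul1r dev0 mul0r subr0.
Qed.

(** The lower estimate is the upper one for [- f]; it may use a slope [d]
    unrelated to [c]. *)
Lemma jensen_of_supports f c d n (x t : 'I_n -> R)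
    (m := \sum_(i < n) t i * x i) :
  (forall i, 0 <= t i) -> \sum_(i < n) t i = 1 ->
  (forall i, f m - f (x i) - (m - x i) * c <= Phi `|m - x i|) ->
  (forall i, - f m - - f (x i) - (m - x i) * d <= Phi `|m - x i|) ->
  `|f m - \sum_(i < n) t i * f (x i)| <= \sum_(i < n) t i * Phi `|m - x i|.
Proof.
move=> t0 t1 up low; rewrite ler_norml (jensen_of_support t0 t1 up) andbT.
have /= := @jensen_of_support (fun z => - f z) d n x t t0 t1 low; rewrite -/m.
under [X in _ - X <= _]eq_bigr do rewrite mulrN.
by rewrite sumrN lerNl opprD.
Qed.

Lemma slope_jensen f : slope_condition I Phi f -> jensen_condition I Phi f.
Proof.
move=> sc n x t Ix t0 t1 /=; set m := \sum_(i < n) t i * x i.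
have Im : I m by apply: interval_barycentre => //; case: hI.
have [c cP] := one_sided_support sc Im.
have [d dP] := one_sided_support (slope_conditionN sc) Im.
apply: (jensen_of_supports t0 t1) => i; first exact: cP (Ix i).
exact: dP (Ix i).
Qed.

Lemma support_jensen f : support_condition I Phi f -> jensen_condition I Phi f.
Proof.
move=> [phi phiP] n x t Ix t0 t1 /=; set m := \sum_(i < n) t i * x i.
have Im : I m by apply: interval_barycentre => //; case: hI.
apply: (@jensen_of_supports _ (phi m) (- phi m) _ _ _ t0 t1) => i;
  have := phiP _ _ (Ix i) Im; rewrite -/m ler_norml => /andP[low up] //.
by move: low; rewrite mulrN; lra.
Qed.

Lemma jensen_affine f : jensen_condition I Phi f -> Phi_affine I Phi f.
Proof.
move=> jen x y t Ix Iy /andP[t0 t1].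
have t1' : 0 <= 1 - t by rewrite subr_ge0.
pose pt (i : 'I_2) := if i == ord0 then x else y.
pose wt (i : 'I_2) := if i == ord0 then t else 1 - t.
have Ipt i : I (pt i) by rewrite /pt; case: ifP.
have wt0 i : 0 <= wt i by rewrite /wt; case: ifP.
have wt1 : \sum_(i < 2) wt i = 1.
  by rewrite big_ord_recl big_ord1 /wt /= addrC subrK.
have := jen 2 pt wt Ipt wt0 wt1; cbv zeta.
rewrite !big_ord_recl !big_ord0 /wt /pt /= !addr0 opprD addrA.
rewrite (_ : t * x + (1 - t) * y - x = - ((1 - t) * (x - y))); last by ring.
rewrite (_ : t * x + (1 - t) * y - y = t * (x - y)); last by ring.
by rewrite normrN !normrM (ger0_norm t0) (ger0_norm t1').
Qed.

End SlopeCondition.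

Theorem theorem3p2 (R : realType) (I : set R) (Phi f : R -> R)
    (hI : open_interval I) (hPhi : error_function I Phi) :
  (Phi_affine I Phi f <-> slope_condition I Phi f) /\
  (Phi_affine I Phi f <-> jensen_condition I Phi f) /\
  (error_increasing I Phi ->
     (Phi_affine I Phi f <-> support_condition I Phi f)).
Proof.
have slope_affine : slope_condition I Phi f -> Phi_affine I Phi f.
  by move=> sc; apply/jensen_affine/slope_jensen.
split; first by split=> //; apply: affine_slope.
split; first by split=> [aff|]; [apply/slope_jensen/affine_slope | apply: jensen_affine].
move=> inc; split=> [aff|supp]; first by apply/slope_support/affine_slope.
exact/jensen_affine/support_jensen.
Qed.
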